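(* Let $G$ be a finite directed graph, $\mathcal H$ its monoid of hikes, and $\Lambda:\mathcal H\to\mathbb N$ the walk von Mangoldt function. Then $$\mathcal S\Lambda(s)=\sum_{h\in\mathcal H}e^{-s\ell(h)}\Lambda(h)\,h=-\frac{\zeta'(s)}{\zeta(s)},$$ where $\zeta'(s):=d\zeta(s)/ds=-\sum_{h\in\mathcal H}e^{-s\ell(h)}\ell(h)\,h$.
   Context: Let $G=(V,E)$ be a finite directed graph with $V=\{v_1,\dots,v_N\}$ and $E\subseteq V^2$ (loops allowed). Each arc $(v_i,v_j)\in E$ is identified with a letter $w_{ij}$. Let $\mathcal M$ be the trace monoid generated by the arcs, i.e. the quotient of the free monoid on the arcs by the relations $w_{ij}w_{kl}=w_{kl}w_{ij}$ for $i\neq k$. The words on the arcs in the equivalence class of an element of $\mathcal M$ are called its representations. A hike is an element $h=w_{i_1j_1}\cdots w_{i_\ell j_\ell}$ of $\mathcal M$ such that for each $i$, $\#\{k: i_k=i\}=\#\{k: j_k=i\}$; its length is $\ell(h)=\ell$. The hikes form a submonoid $\mathcal H$ of $\mathcal M$, containing the empty hike $1$. A word of arcs is contiguous if each arc but the first starts at the vertex where the previous arc ended. The walk von Mangoldt function is defined by: $\Lambda(h)$ is the number of contiguous representations of $h$, for $h\neq1$, and $\Lambda(1)=0$ (so $\Lambda(h)=0$ if $h$ has no contiguous representation). For $f:\mathcal H\to\mathbb R$, $\mathcal Sf(s)=\sum_{h\in\mathcal H}e^{-s\ell(h)}f(h)\,h$ ($s$ a complex variable), a formal series over $\mathcal H$;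 such series are multiplied (non-commutatively) using the multiplication of $\mathcal H$. The zeta function is $\zeta(s)=\sum_{h\in\mathcal H}e^{-s\ell(h)}h$. The quotient $A/B$ of two series denotes right multiplication by the inverse, $A.B^{-1}$. *)

(* Defs.v *)
From HB Require Import structures.
From Stdlib Require Import Relation_Operators.
From mathcomp Require Import all_boot all_order all_algebra.
From mathcomp Require Import generic_quotient.
From mathcomp Require Import all_classical all_reals all_analysis.
From mathcomp Require Import complex.

Set Implicit Arguments.
Unset Strict Implicit.
Unset Printing Implicit Defensive.

Import Order.TTheory GRing.Theory Num.Theory.
Import numFieldNormedType.Exports.

Local Open Scope quotient_scope.
Local Open Scope ring_scope.

Section Digraph.
Variables (V : finType) (E : {set V * V}).

Definition darc : Type := {a : V * V | a \in E}.
HB.instance Definition _ := SubFinite.on darc.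

Definition src (a : darc) : V := (val a).1.
Definition tgt (a : darc) : V := (val a).2.

Inductive arc_swap : seq darc -> seq darc -> Prop :=
  ArcSwap u a b v of src a != src b :
    arc_swap (u ++ [:: a; b] ++ v) (u ++ [:: b; a] ++ v).

(* [arc_swap] is closed under concatenation on both sides, so its equivalence
   closure is the monoid congruence generated by the commutation relations. *)
Definition trace_eq : rel (seq darc) :=
  fun w1 w2 => `[< clos_refl_sym_trans _ arc_swap w1 w2 >].

Lemma trace_eqP w1 w2 :
  reflect (clos_refl_sym_trans _ arc_swap w1 w2) (trace_eq w1 w2).
Proof. exact: asboolP. Qed.

Lemma trace_eq_refl : reflexive trace_eq.
Proof. by move=> w; apply/trace_eqP; exact: rst_refl. Qed.

Lemma trace_eq_sym : symmetric trace_eq.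
Proof. by move=> w1 w2; apply/trace_eqP/trace_eqP; exact: rst_sym. Qed.

Lemma trace_eq_trans : transitive trace_eq.
Proof.
by move=> w2 w1 w3 /trace_eqP h12 /trace_eqP h23; apply/trace_eqP/rst_trans/h23.
Qed.

Canonical trace_equiv :=
  EquivRel trace_eq trace_eq_refl trace_eq_sym trace_eq_trans.

Definition trace : Type := {eq_quot trace_eq}.
HB.instance Definition _ := Choice.on trace.
HB.instance Definition _ := EqQuotient.on trace.

Definition trace_of (w : seq darc) : trace := \pi_trace w.

Lemma trace_ofP w1 w2 :
  trace_of w1 = trace_of w2 <-> clos_refl_sym_trans _ arc_swap w1 w2.
Proof.
split; first by move=> /eqmodP /trace_eqP.
by move=> h; apply/eqmodP/trace_eqP.
Qed.

Lemma trace_of_repr (m : trace) : trace_of (repr m) = m.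
Proof. exact: reprK. Qed.

Lemma trace_eq_repr w : clos_refl_sym_trans _ arc_swap (repr (trace_of w)) w.
Proof. by apply/trace_ofP; rewrite trace_of_repr. Qed.

Lemma trace_eq_cat u1 u2 v1 v2 :
  clos_refl_sym_trans _ arc_swap u1 u2 -> clos_refl_sym_trans _ arc_swap v1 v2 ->
  clos_refl_sym_trans _ arc_swap (u1 ++ v1) (u2 ++ v2).
Proof.
move=> hu hv; apply: (@rst_trans _ _ _ (u2 ++ v1)).
  elim: hu => [_ _ [u a b v ab]|x|x y _|x y z _ h1 _ h2].
  - by rewrite -!catA; apply: rst_step; exact: ArcSwap.
  - exact: rst_refl.
  - exact: rst_sym.
  - exact: rst_trans h2.
elim: hv => [_ _ [u a b v ab]|x|x y _|x y z _ h1 _ h2].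
- by rewrite !(catA u2); apply: rst_step; exact: ArcSwap.
- exact: rst_refl.
- exact: rst_sym.
- exact: rst_trans h2.
Qed.

Lemma trace_eq_perm w1 w2 : clos_refl_sym_trans _ arc_swap w1 w2 -> perm_eq w1 w2.
Proof.
elim=> [_ _ [u a b v _]|x|x y _|x y z _ h1 _ h2].
- by rewrite perm_cat2l perm_cat2r (perm_catC [:: a] [:: b]).
- exact: perm_refl.
- by rewrite perm_sym.
- exact: perm_trans h2.
Qed.

Definition trace_mul (m n : trace) : trace := trace_of (repr m ++ repr n).
Definition trace_one : trace := trace_of [::].

Lemma trace_mulE u v : trace_mul (trace_of u) (trace_of v) = trace_of (u ++ v).
Proof. by apply/trace_ofP/trace_eq_cat; exact: trace_eq_repr. Qed.

Lemma trace_mulA : associative trace_mul.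
Proof.
move=> m n p; rewrite -(trace_of_repr m) -(trace_of_repr n) -(trace_of_repr p).
by rewrite !trace_mulE catA.
Qed.

Lemma trace_mul1 : left_id trace_one trace_mul.
Proof. by move=> m; rewrite -(trace_of_repr m) trace_mulE. Qed.

Lemma trace_mulr1 : right_id trace_one trace_mul.
Proof. by move=> m; rewrite -(trace_of_repr m) trace_mulE cats0. Qed.

HB.instance Definition _ :=
  isMonoid.Build trace trace_mulA trace_mul1 trace_mulr1.

Lemma trace_ofM u v : trace_of (u ++ v) = (trace_of u * trace_of v)%g.
Proof. exact/esym/trace_mulE. Qed.

Definition trace_length (m : trace) : nat := size (repr m).

Lemma trace_length_of w : trace_length (trace_of w) = size w.
Proof. exact/perm_size/trace_eq_perm/trace_eq_repr. Qed.

Lemma trace_lengthM m n :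
  trace_length (m * n)%g = (trace_length m + trace_length n)%N.
Proof.
rewrite -(trace_of_repr m) -(trace_of_repr n) -trace_ofM !trace_length_of.
exact: size_cat.
Qed.

(* Words of length [trace_length m] suffice: see [mem_representations]. *)
Definition representations (m : trace) : {set (trace_length m).-tuple darc} :=
  [set w : (trace_length m).-tuple darc | trace_of w == m].

Lemma mem_representations (m : trace) (w : seq darc) :
  trace_of w = m <-> exists2 t, t \in representations m & w = t.
Proof.
split=> [wm|[t + ->]]; last by rewrite inE => /eqP.
have sw : size w == trace_length m by rewrite -wm trace_length_of.
by exists (Tuple sw) => //; rewrite inE /= wm.
Qed.

Definition contiguous (w : seq darc) : bool :=
  sorted (fun a b => tgt a == src b) w.

Definition balanced (w : seq darc) : bool :=
  [forall i, count (fun a => src a == i) w == count (fun a => tgt a == i) w].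

Lemma perm_balanced w1 w2 : perm_eq w1 w2 -> balanced w1 = balanced w2.
Proof.
by move=> /permP w12; apply: eq_forallb => i; rewrite !w12.
Qed.

Definition is_hike : {pred trace} := [pred m | balanced (repr m)].

Lemma is_hike_of w : (trace_of w \in is_hike) = balanced w.
Proof. exact/perm_balanced/trace_eq_perm/trace_eq_repr. Qed.

Lemma is_hike_monoid_closed : monoid_closed is_hike.
Proof.
split=> [|m n]; first by rewrite is_hike_of; apply/forallP.
rewrite -(trace_of_repr m) -(trace_of_repr n) -trace_ofM !is_hike_of.
move=> /forallP hm /forallP hn; apply/forallP => i.
by rewrite !count_cat (eqP (hm i)) (eqP (hn i)).
Qed.

Definition hike : Type := {m : trace | m \in is_hike}.
HB.instance Definition _ := SubChoice.on hike.
HB.instance Definition _ :=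
  SubChoice_isSubMonoid.Build trace is_hike hike is_hike_monoid_closed.

Definition hike_length (h : hike) : nat := trace_length (val h).

Definition walk_mangoldt (h : hike) : nat :=
  if h == 1%g then 0%N
  else #|[set w in representations (val h) | contiguous w]|.

Lemma hike_lengthM g h :
  hike_length (g * h)%g = (hike_length g + hike_length h)%N.
Proof. by rewrite /hike_length valM trace_lengthM. Qed.

Definition hikes_upto (n : nat) : seq hike :=
  undup (pmap insub
    [seq trace_of w | w <- flatten
       [seq [seq tval t | t <- enum {: k.-tuple darc}] | k <- iota 0 n.+1]]).

Lemma hikes_upto_uniq n : uniq (hikes_upto n).
Proof. exact: undup_uniq. Qed.

Lemma mem_hikes_upto n h : (hike_length h <= n)%N -> h \in hikes_upto n.
Proof.
move=> hn; rewrite mem_undup mem_pmap_sub -(trace_of_repr (val h)).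
apply/map_f/flattenP.
exists [seq tval t | t <- enum {: (size (repr (val h))).-tuple darc}].
  by apply/mapP; exists (size (repr (val h))); rewrite ?mem_iota.
by apply/mapP; exists (in_tuple (repr (val h))); rewrite ?mem_enum.
Qed.

Section FormalSeries.
Variable K : nzRingType.

(* A record, so that the product below is not confused with the pointwise
   product that functions into a ring already carry. *)
Record hseries := HSeries { coef : hike -> K }.
HB.instance Definition _ := [isNew for coef].
HB.instance Definition _ := [Choice of hseries by <:].

Implicit Types f g k : hseries.

Lemma coef_inj f g : coef f =1 coef g -> f = g.
Proof. by move=> fg; apply/val_inj/funext. Qed.

Definition series_add f g := HSeries (fun h => coef f h + coef g h).
Definition series_opp f := HSeries (fun h => - coef f h).
Definition series_zero := HSeries (fun=> 0).
Definition series_one := HSeries (fun h => (h == 1%g)%:R).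
Definition series_mul f g :=
  HSeries (fun h =>
    \sum_(p \in [set p : hike * hike | (p.1 * p.2)%g = h])
       coef f p.1 * coef g p.2).

Lemma coef_seriesD f g h : coef (series_add f g) h = coef f h + coef g h.
Proof. by []. Qed.

Lemma series_addA : associative series_add.
Proof. by move=> f g k; apply: coef_inj => h /=; exact: addrA. Qed.

Lemma series_addC : commutative series_add.
Proof. by move=> f g; apply: coef_inj => h /=; exact: addrC. Qed.

Lemma series_add0 : left_id series_zero series_add.
Proof. by move=> f; apply: coef_inj => h /=; exact: add0r. Qed.

Lemma series_addN : left_inverse series_zero series_opp series_add.
Proof. by move=> f; apply: coef_inj => h /=; exact: addNr. Qed.

HB.instance Definition _ :=
  GRing.isZmodule.Build hseries series_addA series_addC series_add0 series_addN.

Lemma coef_series_mul n f g h : (hike_length h <= n)%N ->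
  coef (series_mul f g) h =
  \sum_(a <- hikes_upto n) \sum_(b <- hikes_upto n | (a * b)%g == h)
     coef f a * coef g b.
Proof.
move=> hn; pose r := [seq (a, b) | a <- hikes_upto n, b <- hikes_upto n].
rewrite /series_mul /= (fsbigE [seq p <- r | (p.1 * p.2)%g == h]).
- rewrite -big_filter -filter_predI.
  rewrite (eq_filter (a2 := fun p => (p.1 * p.2)%g == h)); last first.
    move=> p /=; apply/andP/idP => [[]//|ph]; split=> //.
    by rewrite inE /=; apply/eqP.
  rewrite big_filter [LHS]big_mkcond /r big_allpairs_dep /=.
  by apply: eq_bigr => a _; rewrite [RHS]big_mkcond.
- by rewrite filter_uniq // allpairs_uniq ?hikes_upto_uniq // => -[? ?] [].
- by move=> p /=; rewrite mem_filter => /andP[/eqP].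
- move=> [a b] /= abh /negP[]; rewrite mem_filter /= abh eqxx /=.
  have := hn; rewrite -abh hike_lengthM => abn.
  apply/allpairsP; exists (a, b); split=> //=; apply: mem_hikes_upto.
    exact: leq_trans (leq_addr _ _) abn.
  exact: leq_trans (leq_addl _ _) abn.
Qed.

Lemma sum_hikes_upto n (a : hike) (F : hike -> K) : (hike_length a <= n)%N ->
  \sum_(b <- hikes_upto n | b == a) F b = F a.
Proof.
move=> an; rewrite -big_filter filter_pred1_uniq ?big_seq1 //.
  exact: hikes_upto_uniq.
exact: mem_hikes_upto.
Qed.

Lemma series_mulA : associative series_mul.
Proof.
move=> f g k; apply: coef_inj => h; set n := hike_length h.
set r := hikes_upto n.
transitivity (\sum_(a <- r) \sum_(b <- r) \sum_(c <- r | (a * b * c)%g == h)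
   coef f a * coef g b * coef k c).
  have := @coef_series_mul n g k; move: (series_mul g k) => gk gkE.
  rewrite (@coef_series_mul n) //; apply: eq_bigr => a _.
  under [RHS]eq_bigr => b _ do rewrite big_mkcond.
  rewrite [RHS]exchange_big /=.
  under [RHS]eq_bigr => c _ do rewrite -big_mkcond /=.
  transitivity (\sum_(d <- r | (a * d)%g == h)
      \sum_(b <- r) \sum_(c <- r | (b * c)%g == d)
        coef f a * coef g b * coef k c).
    apply: eq_bigr => d /eqP adh; rewrite gkE.
      rewrite big_distrr /=; apply: eq_bigr => b _; rewrite big_distrr /=.
      by apply: eq_bigr => c _; rewrite mulrA.
    by rewrite /n -adh hike_lengthM leq_addl.
  rewrite exchange_big /=.
  under [RHS]eq_bigr => c _ do rewrite big_mkcond.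
  rewrite [RHS]exchange_big /=; apply: eq_bigr => b _.
  under eq_bigr => d _ do rewrite big_mkcond.
  rewrite exchange_big /=; apply: eq_bigr => c _.
  case: eqP => [abch|abch].
    rewrite -big_mkcondr /= (eq_bigl (fun d => d == (b * c)%g)).
      rewrite (@sum_hikes_upto _ _ (fun=> _)) //.
      by rewrite /n -abch -mulgA [leqRHS]hike_lengthM leq_addl.
    move=> d; rewrite [(b * c)%g == d]eq_sym andbC; case: (d =P _) => // ->.
    by rewrite mulgA abch eqxx.
  rewrite big1 // => d /eqP adh; case: eqP => // bcd.
  by case: abch; rewrite -mulgA bcd.
have := @coef_series_mul n f g; move: (series_mul f g) => fg fgE.
rewrite (@coef_series_mul n) //.
under [RHS]eq_bigr => d _ do rewrite big_mkcond.
rewrite [RHS]exchange_big /=.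
transitivity (\sum_(a <- r) \sum_(c <- r) \sum_(b <- r)
    if (a * b * c)%g == h then coef f a * coef g b * coef k c else 0).
  apply: eq_bigr => a _; under eq_bigr => b _ do rewrite big_mkcond.
  exact: exchange_big.
rewrite exchange_big /=; apply: eq_bigr => c _.
rewrite -big_mkcond /=; transitivity (\sum_(d <- r | (d * c)%g == h)
    \sum_(a <- r) \sum_(b <- r | (a * b)%g == d)
      coef f a * coef g b * coef k c); last first.
  apply: eq_bigr => d /eqP dch; rewrite fgE.
    rewrite big_distrl /=; apply: eq_bigr => a _; rewrite big_distrl /=.
    by apply: eq_bigr => b _.
  by rewrite /n -dch hike_lengthM leq_addr.
rewrite [RHS]exchange_big /=; apply: eq_bigr => a _.
under [RHS]eq_bigr => d _ do rewrite big_mkcond.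
rewrite [RHS]exchange_big /=; apply: eq_bigr => b _.
case: eqP => [abch|abch]; last first.
  rewrite big1 // => d /eqP dch; case: eqP => // abd.
  by case: abch; rewrite abd.
rewrite -big_mkcondr /= (eq_bigl (fun d => d == (a * b)%g)).
  rewrite (@sum_hikes_upto _ _ (fun=> _)) //.
  by rewrite /n -abch [leqRHS]hike_lengthM leq_addr.
move=> d; rewrite [(a * b)%g == d]eq_sym andbC; case: (d =P _) => // ->.
by rewrite abch eqxx.
Qed.

Lemma hike_length1 : hike_length 1%g = 0%N.
Proof. by rewrite /hike_length val1; exact: trace_length_of. Qed.

Lemma series_mul1 : left_id series_one series_mul.
Proof.
move=> f; apply: coef_inj => h; rewrite (@coef_series_mul (hike_length h)) //=.
under eq_bigr => a _ do rewrite -mulr_sumr mulr_natl mulrb /=.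
rewrite -big_mkcond (@sum_hikes_upto _ _
  (fun a => \sum_(b <- _ | (a * b)%g == h) coef f b)) ?hike_length1 //.
under eq_bigl => b do rewrite mul1g.
exact: sum_hikes_upto.
Qed.

Lemma series_mulr1 : right_id series_one series_mul.
Proof.
move=> f; apply: coef_inj => h; rewrite (@coef_series_mul (hike_length h)) //=.
under eq_bigr => a _ do rewrite big_mkcond.
rewrite exchange_big /=.
under eq_bigr => b _ do rewrite -big_mkcond -mulr_suml mulr_natr mulrb /=.
rewrite -big_mkcond (@sum_hikes_upto _ _
  (fun b => \sum_(a <- _ | (a * b)%g == h) coef f a)) ?hike_length1 //.
under eq_bigl => b do rewrite mulg1.
exact: sum_hikes_upto.
Qed.

Lemma series_mulDl : left_distributive series_mul series_add.
Proof.
move=> f g k; apply: coef_inj => h.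
rewrite coef_seriesD !(@coef_series_mul (hike_length h)) // -big_split /=.
apply: eq_bigr => a _; rewrite -big_split /=.
by apply: eq_bigr => b _; rewrite mulrDl.
Qed.

Lemma series_mulDr : right_distributive series_mul series_add.
Proof.
move=> f g k; apply: coef_inj => h.
rewrite coef_seriesD !(@coef_series_mul (hike_length h)) // -big_split /=.
apply: eq_bigr => a _; rewrite -big_split /=.
by apply: eq_bigr => b _; rewrite mulrDr.
Qed.

Lemma series_oner_neq0 : series_one != 0.
Proof.
apply/eqP => /(congr1 (coef^~ 1%g)) /= /eqP.
by rewrite eqxx oner_eq0.
Qed.

HB.instance Definition _ :=
  GRing.Zmodule_isNzRing.Build hseries series_mulA series_mul1 series_mulr1
    series_mulDl series_mulDr series_oner_neq0.

Definition series_unit : pred hseries :=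
  fun f => `[< exists g, g * f = 1 /\ f * g = 1 >].

Definition series_inv f : hseries :=
  if pselect (exists g, g * f = 1 /\ f * g = 1) is left ex
  then projT1 (cid ex) else f.

Lemma series_mulVr : {in series_unit, left_inverse 1 series_inv *%R}.
Proof.
move=> f /asboolP uf; rewrite /series_inv; case: pselect => // ex.
by case: (projT2 (cid ex)).
Qed.

Lemma series_divrr : {in series_unit, right_inverse 1 series_inv *%R}.
Proof.
move=> f /asboolP uf; rewrite /series_inv; case: pselect => // ex.
by case: (projT2 (cid ex)).
Qed.

Lemma series_unitrP f g : g * f = 1 /\ f * g = 1 -> series_unit f.
Proof. by move=> fg; apply/asboolP; exists g. Qed.

Lemma series_inv_out : {in [predC series_unit], series_inv =1 id}.
Proof.
by move=> f /asboolP uf; rewrite /series_inv; case: pselect.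
Qed.

HB.instance Definition _ :=
  GRing.NzRing_hasMulInverse.Build hseries series_mulVr series_divrr
    series_unitrP series_inv_out.

End FormalSeries.
End Digraph.

Local Open Scope complex_scope.

Definition expC (R : realType) (z : R[i]) : R[i] :=
  (expR (complex.Re z))%:C * (cos (complex.Im z) +i* sin (complex.Im z)).

Section Dirichlet.
Variables (V : finType) (E : {set V * V}) (R : realType).

Definition dirichlet (f : hike E -> R) (s : R[i]) : hseries E R[i] :=
  HSeries (fun h => expC (- s * (hike_length h)%:R) * (f h)%:C).

Definition zeta : R[i] -> hseries E R[i] := dirichlet (fun=> 1).

(* Derivatives of formal series are taken coefficientwise; the topology on
   [R[i]] is the one of its regular module [R[i]^o]. *)
Definition series_derivable (F : R[i] -> hseries E R[i]) (s : R[i]) : Prop :=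
  forall h, derivable (fun z : R[i]^o => coef (F z) h : R[i]^o) s 1.

Definition series_derive (F : R[i] -> hseries E R[i]) (s : R[i]) :
    hseries E R[i] :=
  HSeries (fun h => derive1 (fun z : R[i]^o => coef (F z) h : R[i]^o) s).

End Dirichlet.

(* Main.v *)
Require Import Defs.
From Stdlib Require Import Relation_Operators.
From mathcomp Require Import all_boot all_order all_algebra.
From mathcomp Require Import all_classical all_reals all_analysis.
From mathcomp Require Import complex zify ring lra.

Import Order.TTheory GRing.Theory Num.Theory.
Import numFieldNormedType.Exports.
Local Open Scope ring_scope.

Set Implicit Arguments.
Unset Strict Implicit.

(** Arcs with distinct sources commute, so a trace is the same thing as a
    family of words, one for each vertex [i], listing in order the arcs that
    leave [i]. Hence the walks from [i] that divide a hike [h] on the left are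
    the prefixes of a single walk, which leaves each vertex by the first arc
    of [h] not yet used there. As [h] is balanced this walk can only stop at
    [i], once all the arcs of [h] leaving [i] are used; so it returns to [i]
    as many times as there are such arcs. Summing over [i], exactly [l(h)]
    nonempty closed walks divide [h], and by cancellation each has a unique
    cofactor: [S Lambda * zeta = S l = - zeta']. *)

Section Rotor.
Variables (V : finType) (E : {set V * V}).
Local Notation arc := (darc E).
Implicit Types (w p u v : seq arc) (a b : arc) (i j k : V).

(** * Traces as families of words, one for each vertex *)

Definition out w i := [seq a <- w | src a == i].

Lemma out_cat u v i : out (u ++ v) i = out u i ++ out v i.
Proof. exact: filter_cat. Qed.

Lemma size_out w i : size (out w i) = count (fun a => src a == i) w.
Proof. exact: size_filter. Qed.

Lemma trace_of_cons a u v :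
  trace_of u = trace_of v -> trace_of (a :: u) = trace_of (a :: v).
Proof. by rewrite -cat1s -(cat1s _ v) !trace_ofM => ->. Qed.

(** Before its first occurrence [a] meets only arcs with a source other than [i], and it commutes
    with all of them. *)
Lemma out_head_trace {w i a l} : out w i = a :: l ->
  [/\ src a = i, a \in w & trace_of w = trace_of (a :: rem a w)].
Proof.
move=> wal; have : a \in out w i by rewrite wal mem_head.
rewrite mem_filter => /andP[/eqP ai aw]; split=> //.
elim: w aw wal => [//|b w IHw] /=; rewrite inE eq_sym.
case: (eqVneq b a) => [->//|ba] /= aw.
case: (eqVneq (src b) i) => [_ [bE _]|bi wal]; first by rewrite bE eqxx in ba.
rewrite (trace_of_cons _ (IHw aw wal)); apply/trace_ofP/rst_step.
by apply: (@ArcSwap _ _ [::]); rewrite ai.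
Qed.

(** A swap involves two distinct sources, so at most one of the two arcs survives the filter at
    [i]. *)
Lemma trace_of_out u v : trace_of u = trace_of v -> out u =1 out v.
Proof.
move/trace_ofP; elim=> {u v} [_ _ [u a b v ab]|//|u v _ uv|x y z _ xy _ yz] i.
- rewrite !out_cat; congr (_ ++ (_ ++ _)) => /=.
  by case: eqP => [ai|_]; case: eqP => // bi; rewrite ai bi eqxx in ab.
- by rewrite uv.
- by rewrite xy yz.
Qed.

(** The first arc of [u] heads the list of its source in [v] too, so it can be moved to the front of
    [v] and cancelled. *)
Lemma trace_of_outP u v : trace_of u = trace_of v <-> out u =1 out v.
Proof.
split=> [|]; first exact: trace_of_out.
elim: u v => [|a u IHu] v uv.
  by case: v uv => // b v /(_ (src b)); rewrite /= eqxx.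
have := uv (src a); rewrite /= eqxx => /esym va.
have [_ av vE] := out_head_trace va.
rewrite vE; apply: trace_of_cons; apply: IHu => i.
by have := trace_of_out vE i; rewrite -uv /=; case: eqP => _ // [].
Qed.

(** Cancellation holds vertex by vertex, in free monoids. *)
Lemma trace_mulIl (m : trace E) : injective (fun n => m * n)%g.
Proof.
move=> m1 m2; rewrite -(trace_of_repr m) -(trace_of_repr m1).
rewrite -(trace_of_repr m2) -!trace_ofM !trace_of_outP => m12 i.
by apply/eqP; have := m12 i; rewrite !out_cat => /eqP; rewrite eqseq_cat // eqxx.
Qed.

Lemma hike_mulIl (h : hike E) : injective (fun g => h * g)%g.
Proof.
by move=> h1 h2 /(congr1 val); rewrite !valM => /trace_mulIl /val_inj.
Qed.

(** * Walks, flow counts and the rotor walk *)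

Fixpoint walk_from i p : bool :=
  if p is a :: p' then (src a == i) && walk_from (tgt a) p' else true.

Definition walk_end i p : V := last i (map (@tgt _ E) p).

Lemma contiguous_cons a p : contiguous (a :: p) = walk_from (src a) (a :: p).
Proof.
rewrite /contiguous /= eqxx; elim: p a => //= b p IHp a.
by rewrite IHp eq_sym.
Qed.

(** Both sides count the visits to [k]: each visit is a departure or the end, and an arrival or the
    start. *)
Lemma walk_from_flow i p k : walk_from i p ->
  (count (fun a => src a == k) p + (walk_end i p == k) =
   count (fun a => tgt a == k) p + (i == k))%N.
Proof.
rewrite /walk_end; elim: p i => //= a p IHp i /andP[/eqP ai /IHp {}IHp].
by rewrite ai; lia.
Qed.

Lemma walk_balanced i p : walk_from i p -> balanced p = (walk_end i p == i).
Proof.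
move=> wp; apply/forallP/eqP => [bp|pi k].
  have := walk_from_flow i wp; rewrite (eqP (bp i)) eqxx.
  by case: eqP => //; lia.
by apply/eqP; have := walk_from_flow k wp; rewrite pi; lia.
Qed.

(* The walk from [i] that leaves each vertex by the first arc of [w] not yet
   used there; [n] is fuel, [size w] is enough. *)
Fixpoint rotor n i w : seq arc :=
  if n is n'.+1 then
    if out w i is a :: _ then a :: rotor n' (tgt a) (rem a w) else [::]
  else [::].

(** A walk from [i] dividing [w] must begin with the head of [out w i], as this list depends only on
    the trace; cancel that arc and recurse. *)
Lemma rotor_prefixP n i w p : (size w <= n)%N ->
  reflect (walk_from i p /\ exists v, trace_of w = trace_of (p ++ v))
          (prefix p (rotor n i w)).
Proof.
elim: n i w p => [|n IHn] i w [|a p] wn.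
- by rewrite prefix0s; apply: ReflectT; split=> //; exists w.
- apply: ReflectF => -[_ [v /(congr1 (@trace_length _ _))]].
  by rewrite !trace_length_of /=; lia.
- by rewrite prefix0s; apply: ReflectT; split=> //; exists w.
rewrite /rotor -/rotor; case wi: (out w i) => [|b l].
  apply: ReflectF => -[/andP[/eqP ai _] [v /trace_of_out /(_ i)]].
  by rewrite wi /= ai eqxx.
have [bi bw wE] := out_head_trace wi.
have rn : (size (rem b w) <= n)%N by rewrite size_rem // -subn1 leq_subLR.
rewrite prefix_cons; apply: (iffP andP).
  move=> [/eqP -> /(IHn _ _ _ rn) [pw [v rv]]].
  split; first by rewrite /= bi eqxx.
  by exists v; rewrite wE; exact: trace_of_cons.
move=> [/andP[/eqP ai pw] [v wv]].
have ab : a = b by have := trace_of_out wv i; rewrite wi /= ai eqxx => -[].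
split; first by rewrite ab.
apply/(IHn _ _ _ rn); rewrite -ab; split=> //; exists v.
apply/(@trace_mulIl (trace_of [:: a])); rewrite -!trace_ofM !cat1s.
by rewrite -wv wE ab.
Qed.

(** The hypothesis gives [w] the arc counts of a walk from [i] to [j]; removing the first arc moves
    [i] to its target and preserves this. The conclusion counts the visits to [j]. *)
Lemma count_tgt_rotor n i j w : (size w <= n)%N ->
  (forall k, count (fun a => src a == k) w + (j == k) =
             count (fun a => tgt a == k) w + (i == k))%N ->
  (count (fun a => tgt a == j) (rotor n i w) + (i == j) =
   (count (fun a => src a == j) w).+1)%N.
Proof.
elim: n i w => [|n IHn] i w wn fl.
  case: w wn fl => // _ /(_ i) /=; rewrite eqxx eq_sym; lia.
rewrite /rotor -/rotor; case wi: (out w i) => [|a l].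
  have w0 : count (fun a => src a == i) w = 0%N by rewrite -size_out wi.
  have := fl i; rewrite w0 eqxx eq_sym; case: (eqVneq i j) => [<-|] /=; lia.
have [ai aw wE] := out_head_trace wi.
have pw : perm_eq w (a :: rem a w) by exact: perm_to_rem.
have {}fl k : (count (fun a => src a == k) (rem a w) + (j == k) =
               count (fun a => tgt a == k) (rem a w) + (tgt a == k))%N.
  by have := fl k; rewrite !(permP pw) /= ai; lia.
have rn : (size (rem a w) <= n)%N by rewrite size_rem // -subn1 leq_subLR.
have /= := IHn (tgt a) (rem a w) rn fl; rewrite (permP pw) /= ai; lia.
Qed.

(** * Closed walks dividing a hike *)

Definition closed_walks w : seq (seq arc) :=
  [seq p <- [seq take m.+1 (rotor (size w) i w) |
             i <- enum V, m <- iota 0 (size (rotor (size w) i w))]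
   | balanced p].

(** By [rotor_prefixP] the walks from a vertex dividing [w] are the prefixes of its rotor walk;
    [m.+1] leaves out the empty one. *)
Lemma mem_closed_walks w p : p \in closed_walks w =
  [&& p != [::], contiguous p, balanced p &
      `[< exists v, trace_of w = trace_of (p ++ v) >]].
Proof.
rewrite mem_filter andbC; apply/andP/and4P.
  move=> [/allpairsPdep [i [k [_]]]].
  rewrite mem_iota add0n => /andP[_ kn] pE bp.
  have : prefix p (rotor (size w) i w) by rewrite pE; exact: prefix_take.
  move=> /(rotor_prefixP _ _ (leqnn _)) [pw /asboolP pv].
  have p0 : p != [::] by rewrite -size_eq0 pE size_takel.
  split=> //; case: p p0 pw {pE bp pv} => // a p _ /andP[/eqP ai pw].
  by rewrite contiguous_cons /= eqxx.
move=> [p0 cp bp /asboolP pv]; split=> //.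
case: p p0 cp bp pv => // a p _; rewrite contiguous_cons => cp bp pv.
have /prefixP [q rE] : prefix (a :: p) (rotor (size w) (src a) w).
  by apply/rotor_prefixP.
apply/allpairsPdep; exists (src a), (size p); rewrite mem_enum mem_iota.
by rewrite rE /= size_cat take_size_cat //; split=> //; lia.
Qed.

(** The length of a prefix determines [m], and the source of its first arc determines [i]. *)
Lemma closed_walks_uniq w : uniq (closed_walks w).
Proof.
apply/filter_uniq/allpairs_uniq_dep.
- exact: enum_uniq.
- by move=> i _; exact: iota_uniq.
move=> _ _ /allpairsPdep [i [m [_ mi ->]]] /allpairsPdep [i' [m' [_ mi' ->]]] /=.
move: mi mi'; rewrite !mem_iota !add0n /= => mi mi' mm.
have := congr1 size mm; rewrite !size_takel // => -[mE].
suff -> : i = i' by rewrite mE.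
have first_arc n j l : (l < size (rotor n j w))%N ->
    exists a q, take l.+1 (rotor n j w) = a :: q /\ src a = j.
  case: n => //= n; case wj: (out w j) => [|a s] //= _.
  by have [aj _ _] := out_head_trace wj; eexists; eexists; split; first by [].
have [a [q [qE <-]]] := first_arc _ _ _ mi.
have [a' [q' [qE' <-]]] := first_arc _ _ _ mi'.
by move: mm; rewrite qE qE' => -[->].
Qed.

(** The rotor walk from [i] returns to [i] once for each arc of [w] leaving [i]; summing over [i]
    counts every arc once, by its source. *)
Lemma size_closed_walks w : balanced w -> size (closed_walks w) = size w.
Proof.
move=> bw.
rewrite size_filter /allpairs count_flatten -map_comp sumnE big_map big_enum /=.
transitivity (\sum_(i : V) count (fun a => src a == i) w)%N; last first.
  rewrite -sum1_size; under eq_bigr do rewrite -sum1_count big_mkcond.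
  rewrite exchange_big /=; apply: eq_bigr => a _.
  by rewrite -big_mkcond (big_pred1 (src a)) // => i; rewrite eq_sym.
apply: eq_bigr => i _.
have fl : forall k, (count (fun a => src a == k) w + (i == k) =
             count (fun a => tgt a == k) w + (i == k))%N.
  by move=> k; rewrite (eqP (forallP bw k)).
have := count_tgt_rotor (leqnn _) fl; rewrite eqxx addn1 => -[<-].
set q := rotor _ _ _; rewrite count_map.
have qw : walk_from i q.
  by have /(rotor_prefixP _ _ (leqnn _)) [] := prefix_refl q.
(* The prefix of length [m.+1] is closed exactly when its last arc, at index [m], ends at [i]. *)
rewrite (eq_in_count (a2 := fun m => nth false (map (fun a => tgt a == i) q) m)).
  rewrite -[RHS](count_map (fun a => tgt a == i) id q).
  rewrite -{2}[map _ q](mkseq_nth false) count_map size_map.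
  by apply: eq_count.
move=> m; rewrite mem_iota add0n => /= mq.
have tw : walk_from i (take m.+1 q).
  elim: (q) (i) (m.+1) qw => [|a q' IH] j [|l] //= /andP[-> /IH]; exact.
case: (q) mq tw => // a0 s mq tw.
rewrite (walk_balanced tw) (nth_map a0) // /walk_end (take_nth a0) //.
by rewrite map_rcons last_rcons.
Qed.

(** Sorts the closed walks dividing [h] by their trace [a]; cancellation gives each such [a] a
    single cofactor [b]. *)
Lemma sum_walk_mangoldt (h : hike E) (n := hike_length h) :
  (\sum_(a <- hikes_upto E n) \sum_(b <- hikes_upto E n | (a * b)%g == h)
     walk_mangoldt a = n)%N.
Proof.
pose w := repr (val h); have hE : trace_of w = val h by rewrite trace_of_repr.
have bw : balanced w by exact: (valP h).
transitivity (\sum_(a <- hikes_upto E n)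
    \sum_(p <- closed_walks w | trace_of p == val a) 1)%N; last first.
  under eq_bigr do rewrite big_mkcond.
  rewrite exchange_big /= -[RHS](size_closed_walks bw) -sum1_size.
  rewrite [LHS]big_seq [RHS]big_seq; apply: eq_bigr => p.
  rewrite mem_closed_walks => /and4P[_ _ bp /asboolP [v wv]].
  have ph : trace_of p \in @is_hike V E by rewrite is_hike_of.
  rewrite -big_mkcond /= (eq_bigl (pred1 (Sub (trace_of p) ph : hike E))).
    rewrite -big_filter filter_pred1_uniq ?big_seq1 ?hikes_upto_uniq //.
    apply: mem_hikes_upto; rewrite /n /hike_length SubK -hE wv.
    by rewrite !trace_length_of size_cat leq_addr.
  by move=> a /=; rewrite eq_sym -val_eqE.
apply: eq_bigr => a _; rewrite sum1_count -size_filter.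
set s := [seq p <- _ | _].
have sP p : p \in s =
    [&& trace_of p == val a, p != [::], contiguous p, balanced p &
        `[< exists v, trace_of w = trace_of (p ++ v) >]].
  by rewrite mem_filter mem_closed_walks.
have [[b abh]|nab] := pselect (exists b : hike E, (a * b)%g = h); last first.
  rewrite big_hasC; last first.
    by apply/hasPn => b _; apply/eqP => abh; apply: nab; exists b.
  apply/esym/eqP; rewrite size_eq0; apply/eqP; case sE : s => [//|p s'].
  have : p \in s by rewrite sE mem_head.
  rewrite sP => /and5P[/eqP pa _ _ bp /asboolP [v wv]]; case: nab.
  (* The cofactor of a balanced word in a balanced word is balanced, hence a hike. *)
  have vh : trace_of v \in @is_hike V E.
    rewrite is_hike_of; apply/forallP => i.
    have /trace_ofP /trace_eq_perm /permP pwv := wv.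
    have := forallP bw i; rewrite !pwv !count_cat (eqP (forallP bp i)).
    by rewrite eqn_add2l.
  exists (Sub (trace_of v) vh); apply: val_inj.
  by rewrite valM SubK -pa -trace_ofM -wv.
rewrite (eq_bigl (pred1 b)); last first.
  by move=> c /=; rewrite -abh (inj_eq (@hike_mulIl a)).
rewrite -big_filter filter_pred1_uniq ?hikes_upto_uniq //; last first.
  by apply: mem_hikes_upto; rewrite /n -abh hike_lengthM leq_addl.
(* For [a = 1] the value 0 agrees with the absence of the empty word from [closed_walks]. *)
rewrite big_seq1 /walk_mangoldt; case: eqP => [a1|a1].
  apply/esym/eqP; rewrite size_eq0; apply/eqP; case sE : s => [//|p s'].
  have : p \in s by rewrite sE mem_head.
  rewrite sP => /and5P[/eqP pa p0 _ _ _]; move: p0.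
  by rewrite -size_eq0 -trace_length_of pa -/(hike_length a) a1 hike_length1.
set T := [set _ in _ | _]%SET.
rewrite cardE -(size_map val); apply/perm_size/uniq_perm.
- by rewrite map_inj_uniq ?enum_uniq //; exact: val_inj.
- exact/filter_uniq/closed_walks_uniq.
move=> p; rewrite sP; apply/mapP/and5P.
  move=> [t]; rewrite mem_enum !inE => /andP[/eqP ta ct] ->; split=> //.
  - by rewrite ta.
  - by apply/eqP => t0; apply: a1; apply: val_inj; rewrite -ta t0 val1.
  - by rewrite -is_hike_of ta; exact: (valP a).
  - exists (repr (val b)).
    by rewrite trace_ofM ta trace_of_repr -valM abh hE.
move=> [/eqP pa _ cp _ _].
have [t tr pt] := (mem_representations (val a) p).1 pa.
by exists t => //; rewrite mem_enum inE tr -pt.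
Qed.

End Rotor.

(** * Derivative of the complex exponential *)

Section Derivative.
Local Open Scope classical_set_scope.

(** Multiplying out the difference quotient gives a linear bound; [K] is general so as to carry real
    derivatives over to [R[i]]. *)
Lemma is_derive1P (K : numFieldType) (f : K -> K) (a d : K) :
  is_derive (a : K^o) 1 (f : K^o -> K^o) d <->
  forall e, 0 < e -> \forall x \near (0 : K^o),
    `|f (x + a) - f a - x * d| <= e * `|x|.
Proof.
have cvgP :
  (fun h : K^o =>
     h^-1 *: (((f : K^o -> K^o) \o shift a) (h *: (1 : K^o)) - f a))
    @ 0^' --> (d : K^o) <->
  forall e, 0 < e -> \forall x \near (0 : K^o),
    `|f (x + a) - f a - x * d| <= e * `|x|.
  have E (x e : K) : x != 0 ->
    (`|d - x^-1 * (f (x * 1 + a) - f a)| <= e) =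
    (`|f (x + a) - f a - x * d| <= e * `|x|).
    move=> x0; rewrite mulr1 -ler_pdivrMr ?normr_gt0// -normfV -normrM distrC.
    by congr (`|_| <= _); field.
  split=> [/cvgrPdist_le fd e e0|fd].
    have := fd e e0; rewrite near_withinE; apply: filter_app; near=> x.
    (* At 0, excluded from the punctured limit, both sides of the bound vanish. *)
    have [->|x0] := eqVneq x 0; last by move=> /(_ isT); rewrite -E.
    by rewrite add0r subrr mul0r subrr !normr0 mulr0.
  apply/cvgrPdist_le => e e0; rewrite near_withinE.
  by apply: filter_app (fd e e0); near=> x => + x0; rewrite -E.
split=> [[df dE]|fd].
  by apply/cvgP; rewrite -dE.
have {}fd := cvgP.2 fd.
by split; [apply/cvg_ex; exists d|apply: cvg_lim].
Unshelve. all: by end_near.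
Qed.

Variable R : realType.
Local Open Scope complex_scope.

Lemma expCD (z w : R[i]) : expC (z + w) = expC z * expC w.
Proof.
case: z w => [a b] [c d]; rewrite /expC /= expRD cosD sinD.
by simpc; congr (_ +i* _); ring.
Qed.

Lemma expC0 : expC 0 = 1 :> R[i].
Proof. by rewrite /expC /= expR0 cos0 sin0; simpc. Qed.

Lemma norm_cis (y : R) : `|cos y +i* sin y| = 1.
Proof. by rewrite normc_def /= cos2Dsin2 sqrtr1. Qed.

Lemma norm_real_complex (x : R) : `|x%:C| = `|x|%:C.
Proof. by rewrite normc_def /= expr0n addr0 sqrtr_sqr. Qed.

Lemma norm_imaginary (x : R) : `|0 +i* x| = `|x|%:C.
Proof. by rewrite normc_def /= expr0n add0r sqrtr_sqr. Qed.

Lemma norm_complex_le (x y : R) : `|x +i* y| <= (`|x| + `|y|)%:C.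
Proof.
have -> : x +i* y = x%:C + (0 +i* y) by simpc.
by rewrite (le_trans (ler_normD _ _))// norm_real_complex norm_imaginary rmorphD.
Qed.

Lemma normc_ge_Im (z : R[i]) : `|complex.Im z|%:C <= `|z|.
Proof.
by rewrite normc_def lecR -sqrtr_sqr ler_wsqrtr// lerDr sqr_ge0.
Qed.

Lemma is_derive_expC0 : is_derive (0 : R[i]^o) 1 (@expC R : R[i]^o -> R[i]^o) 1.
Proof.
(* Positivity in [R[i]] forces the tolerance to be real. *)
apply/is_derive1P => -[e e']; rewrite ltcE /= => /andP[/eqP -> e0] {e'}.
(* With [N] the modulus, the errors below add up to at most [6 * d * N], hence to at most
   [e * N / 2]; [d <= 1] serves to bound [sin y] by twice [y] in absolute value. *)
pose d := Num.min (e / 12) 1.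
have d0 : 0 < d by rewrite lt_min ltr01 divr_gt0.
have dle : d <= e / 12 by rewrite ge_min lexx.
have d1 : d <= 1 by rewrite ge_min lexx orbT.
clearbody d.
have := (is_derive1P expR 0 (expR 0)).1 (is_derive_expR 0) _ d0.
have := (is_derive1P cos 0 (- sin 0)).1 (is_derive_cos 0) _ d0.
have := (is_derive1P sin 0 (cos 0)).1 (is_derive_sin 0) _ d0.
rewrite sin0 cos0 expR0 oppr0 => /nbhs_ballP [r1 r10 Hs].
move=> /nbhs_ballP [r2 r20 Hc] /nbhs_ballP [r3 r30 He].
pose r := Num.min (Num.min r1 r2) (Num.min r3 d).
have r0 : 0 < r by rewrite !lt_min r10 r20 r30 d0.
apply/nbhs_ballP; exists r%:C; first by rewrite /= ltcR.
move=> z; rewrite -ball_normE /= sub0r normrN => zr.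
have := normc_ge_Re z; have := normc_ge_Im z; move: zr.
case: z => x y; rewrite normc_def /=; set N := Num.sqrt _.
rewrite ltcR !lecR => Nr yN xN.
have := Nr; rewrite !lt_min => /andP[/andP[N1 N2] /andP[N3 Nd]].
have {}Hs : `|sin y - y| <= d * `|y|.
  have := Hs y; rewrite -ball_normE /= sub0r normrN !(addr0, subr0, mulr1); apply.
  exact: le_lt_trans N1.
have {}Hc : `|cos y - 1| <= d * `|y|.
  have := Hc y; rewrite -ball_normE /= sub0r normrN !(addr0, mulr0, subr0); apply.
  exact: le_lt_trans N2.
have {}He : `|expR x - 1 - x| <= d * `|x|.
  have := He x; rewrite -ball_normE /= sub0r normrN !(addr0, mulr1); apply.
  exact: le_lt_trans N3.
rewrite addr0 expC0 mulr1.
(* With c = cos y + i sin y, this splits e^x c - 1 - z into (e^x - 1 - x) c, c - 1 - iy and x (c -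
   1), each of which is o(|z|). *)
have -> : expC (x +i* y) - 1 - (x +i* y) =
    (expR x - 1 - x)%:C * (cos y +i* sin y) +
    ((cos y - 1) +i* (sin y - y)) +
    x%:C * ((cos y - 1) +i* sin y).
  by rewrite /expC /=; simpc; congr (_ +i* _); ring.
have sy : `|sin y| <= 2 * `|y|.
  rewrite -(subrK y (sin y)) (le_trans (ler_normD _ _))//.
  have := ler_wpM2r (normr_ge0 y) d1; lra.
apply: le_trans (ler_normD _ _) _.
apply: le_trans (lerD (ler_normD _ _) (lexx _)) _.
rewrite !normrM norm_cis mulr1 !norm_real_complex.
apply: le_trans (lerD (lerD (lexx _) (norm_complex_le _ _))
  (ler_wpM2l _ (norm_complex_le _ _))) _; first by rewrite lecR.
rewrite -[e +i* 0]/(e%:C) -rmorphM /= -rmorphM /= -rmorphD /= -rmorphD /= lecR.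
have x0 := normr_ge0 x; have y0 := normr_ge0 y.
have xd : `|x| <= d by apply: le_trans xN (ltW Nd).
have : `|x| * (`|cos y - 1| + `|sin y|) <= d * (3 * `|y|).
  apply: ler_pM => //.
  have := ler_wpM2r y0 d1; lra.
have := ler_wpM2l (ltW d0) xN; have := ler_wpM2l (ltW d0) yN.
have N0 : 0 <= N by apply: le_trans xN.
have := ler_wpM2r N0 dle.
have := mulr_ge0 (ltW e0) N0.
lra.
Qed.

(** The functional equation [expCD] reduces the estimate at [s] to the one at 0. *)
Lemma is_derive_expCM (r s : R[i]) :
  is_derive (s : R[i]^o) 1 (fun z : R[i]^o => expC (r * z) : R[i]^o)
    (r * expC (r * s)).
Proof.
apply/is_derive1P => e e0.
set M := expC (r * s).
(* The added 1 keeps the divisors nonzero when [r = 0], the case of the empty hike. *)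
have r1 : 0 < `|r| + 1 by rewrite ltr_wpDl.
have M1 : 0 < `|M| + 1 by rewrite ltr_wpDl.
have key (m q y : R[i]) : 0 <= m -> 0 <= q -> 0 <= y ->
    m * (e / ((q + 1) * (m + 1)) * (q * y)) <= e * y.
  move=> m0 q0 y0; have m1 : 0 < m + 1 by rewrite ltr_wpDl.
  have q1 : 0 < q + 1 by rewrite ltr_wpDl.
  rewrite [leLHS](_ : _ = (m / (m + 1)) * (q / (q + 1)) * (e * y)); last first.
    by field; rewrite !gt_eqF.
  rewrite -[leRHS]mul1r ler_wpM2r ?mulr_ge0 ?(ltW e0)//.
  by rewrite mulr_ile1 ?divr_ge0 ?(ltW m1) ?(ltW q1)// ler_pdivrMr// mul1r lerDl.
have e'0 : 0 < e / ((`|r| + 1) * (`|M| + 1)) by rewrite divr_gt0// mulr_gt0.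
have /nbhs_ballP [d d0 Hd] := (is_derive1P _ _ _).1 is_derive_expC0 _ e'0.
apply/nbhs_ballP; exists (d / (`|r| + 1)); first by rewrite /= divr_gt0.
move=> x; rewrite -ball_normE /= sub0r normrN ltr_pdivlMr// => xd.
have /Hd /= : ball (0 : R[i]^o) d (r * x).
  rewrite -ball_normE /= sub0r normrN normrM; apply: le_lt_trans xd.
  by rewrite mulrC ler_wpM2l// lerDl.
rewrite addr0 expC0 mulr1 => rx.
have -> : expC (r * (x + s)) - M - x * (r * M) = M * (expC (r * x) - 1 - r * x).
  by rewrite mulrDr expCD -/M; ring.
rewrite normrM (le_trans (ler_wpM2l _ rx))// [`|r * x|]normrM.
exact: key.
Qed.

End Derivative.

(** * Invertibility of series with constant coefficient 1 *)

Section SeriesUnit.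
Variables (V : finType) (E : {set V * V}) (K : nzRingType).
Implicit Types (f g : hseries E K) (h : hike E).

Lemma hike_length_eq0 h : hike_length h = 0%N -> h = 1%g.
Proof.
move=> /size0nil h0; apply: val_inj; rewrite val1.
by rewrite -[LHS]trace_of_repr h0.
Qed.

(** Factors of [h] are no longer than [h]; this lets a truncation stand for the infinite sum of
    powers. *)
Lemma eq_coef_mul f f' g g' h :
  (forall a, (hike_length a <= hike_length h)%N -> coef f a = coef f' a) ->
  (forall a, (hike_length a <= hike_length h)%N -> coef g a = coef g' a) ->
  coef (f * g) h = coef (f' * g') h.
Proof.
move=> ff gg; rewrite !(coef_series_mul _ _ (leqnn _)).
apply: eq_bigr => a _; apply: eq_bigr => b /eqP abh.
by rewrite ff ?gg // -abh hike_lengthM ?leq_addr ?leq_addl.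
Qed.

(** Without a constant term, each of the [k] factors [g] contributes length at least 1. *)
Lemma coef_exp_eq0 g k h :
  coef g 1%g = 0 -> (hike_length h < k)%N -> coef (g ^+ k) h = 0.
Proof.
move=> g1; elim: k h => // k IHk h hk; rewrite exprS.
rewrite (coef_series_mul _ _ (leqnn _)) big1 // => a _.
rewrite big1 // => b /eqP abh.
have [a0|a0] := posnP (hike_length a).
  by rewrite (hike_length_eq0 a0) g1 mul0r.
rewrite IHk ?mulr0 //; move: hk; rewrite -abh hike_lengthM; lia.
Qed.

Lemma coef_sum (I : Type) (r : seq I) (F : I -> hseries E K) h :
  coef (\sum_(i <- r) F i) h = \sum_(i <- r) coef (F i) h.
Proof. exact: (big_morph (fun f => coef f h)). Qed.

(* Writing [f = 1 - g], the inverse is the sum of the powers of [g], of which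
   only the first [n + 1] contribute in length [n]. *)
Lemma series_unit1 f : coef f 1%g = 1 -> f \is a GRing.unit.
Proof.
move=> f1; pose g := 1 - f; pose G n := \sum_(0 <= k < n) g ^+ k.
have g1 : coef g 1%g = 0.
  by rewrite -[LHS]/((1%g == 1%g :> hike E)%:R - coef f 1%g) eqxx f1 subrr.
pose fi := HSeries (fun h => coef (G (hike_length h).+1) h).
have fiE n a : (hike_length a <= n)%N -> coef fi a = coef (G n.+1) a.
  move=> an; rewrite /fi /= /G !coef_sum.
  rewrite [RHS](big_cat_nat _ (n := (hike_length a).+1)) //=.
  rewrite [X in _ + X]big_nat [X in _ + X]big1 ?addr0 //.
  by move=> k /andP[ak _]; exact: coef_exp_eq0.
have fG n : f * G n = 1 - g ^+ n.
  rewrite -opprB subrX1 -mulNr opprB /g opprB addrCA subrr addr0.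
  by rewrite /G big_mkord.
(* [G n] is a polynomial in [f], so it commutes with [f] and one computation serves both sides. *)
have Gf n : G n * f = f * G n.
  rewrite /G big_mkord; apply/esym/commr_sum => k _; apply: commrX.
  by apply: commrB; [exact: commr1|].
have fGE h : coef (f * G (hike_length h).+1) h = coef (1 : hseries E K) h.
  rewrite fG -[LHS]/(coef 1 h - coef (g ^+ (hike_length h).+1) h).
  by rewrite coef_exp_eq0 // subr0.
apply/unitrP; exists fi; split; apply: coef_inj => h; rewrite -fGE.
  by rewrite -Gf; apply: eq_coef_mul => // a; exact: fiE.
by apply: eq_coef_mul => // a; exact: fiE.
Qed.

End SeriesUnit.

(** * The product with zeta and the final identity *)

Lemma mangoldt_mul_zeta (V : finType) (E : {set V * V}) (R : realType)
    (s : R[i]) :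
  dirichlet (fun h : hike E => (walk_mangoldt h)%:R) s * zeta E s =
  dirichlet (fun h : hike E => (hike_length h)%:R) s.
Proof.
apply: coef_inj => h; rewrite (coef_series_mul _ _ (leqnn _)) /=.
(* Lengths add, so the two exponentials combine into a factor common to all factorisations of
   [h]. *)
transitivity (\sum_(a <- hikes_upto E (hike_length h))
    \sum_(b <- hikes_upto E (hike_length h) | (a * b)%g == h)
      expC (- s * (hike_length h)%:R) * (walk_mangoldt a)%:R).
  apply: eq_bigr => a _; apply: eq_bigr => b /eqP abh.
  rewrite !rmorph_nat mulr1 mulrAC -expCD -mulrDr -natrD.
  by rewrite -hike_lengthM abh.
under eq_bigr do rewrite -mulr_sumr -natr_sum.
by rewrite -mulr_sumr -natr_sum sum_walk_mangoldt rmorph_nat.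
Qed.

Lemma is_derive_zeta (V : finType) (E : {set V * V}) (R : realType)
    (s : R[i]) (h : hike E) :
  is_derive (s : R[i]^o) 1 (fun z : R[i]^o => coef (zeta E z) h : R[i]^o)
    (- coef (dirichlet (fun h : hike E => (hike_length h)%:R) s) h).
Proof.
have zE z : coef (zeta E z) h = expC (- (hike_length h)%:R * z).
  by rewrite /= rmorph1 mulr1 !mulNr [z * _]mulrC.
rewrite (_ : (fun z => _) =
  (fun z : R[i]^o => expC (- (hike_length h)%:R * z) : R[i]^o)); last first.
  by apply/funext => z; exact: zE.
have := is_derive_expCM (- (hike_length h)%:R) s.
rewrite -zE /= rmorph1 mulr1 rmorph_nat.
by rewrite mulNr mulrC.
Qed.

Theorem proposition3p4 (V : finType) (E : {set V * V}) (R : realType)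
    (s : R[i]) :
  [/\ series_derivable (zeta E (R := R)) s,
      series_derive (zeta E (R := R)) s
        = - dirichlet (fun h : hike E => (hike_length h)%:R) s,
      zeta E s \is a GRing.unit
    & dirichlet (fun h : hike E => (walk_mangoldt h)%:R) s
        = - (series_derive (zeta E (R := R)) s / zeta E s)].
Proof.
have dz : series_derive (zeta E (R := R)) s
    = - dirichlet (fun h : hike E => (hike_length h)%:R) s.
  apply: coef_inj => h; rewrite /series_derive /= derive1E.
  by have [_ ->] := is_derive_zeta s h.
have uz : zeta E s \is a GRing.unit.
  by apply: series_unit1; rewrite /= hike_length1 mulr0 expC0 rmorph1 mulr1.
split=> //; first by move=> h; have [] := is_derive_zeta s h.
by rewrite dz mulNr opprK -mangoldt_mul_zeta mulrK.
Qed.
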